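(* For a random graph $G(n,m)$ with $m=2^i n\log n$, its DFS tree will have a stick of length at least $n-n/2^i$ with probability $1-O(1/n)$.
   Context: Random graph: $G(n,m)$ is the graph on $n$ vertices consisting of the first $m$ edges of a uniformly random permutation of all possible edges ($\log$ is the natural logarithm). DFS tree: a rooted spanning tree produced by a depth-first search traversal of the graph. The graph is augmented with a dummy vertex $s$ (the pseudo root) adjacent to all vertices, and the DFS tree is rooted at $s$, so that each subtree rooted at a child of $s$ is a DFS tree of a connected component of the original graph. For undirected graphs, a rooted spanning tree is a DFS tree if and only if every non-tree edge joins a vertex to one of its ancestors. Stick: from the root of the DFS tree there is a downward path on which there is no branching, i.e. every vertex has exactly one child. This path is called the stick; the remaining part of the DFS tree is called the bristles. *)

(* Defs.v *)
From HB Require Import structures.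
From mathcomp Require Import all_boot all_order all_algebra perm.
From mathcomp Require Import boolp reals exp.

Set Implicit Arguments.
Unset Strict Implicit.
Unset Printing Implicit Defensive.

Import Order.TTheory GRing.Theory Num.Theory.
Local Open Scope ring_scope.

Notation edge n := {e : {set 'I_n} | #|e| == 2%N}.

(* The graph G(n, m), as a function of the random permutation of the edges. *)
Definition gnm (n m : nat) (sigma : {perm edge n}) : rel 'I_n :=
  fun u v => [set u; v] \in [seq val (sigma e) | e <- take m (enum {: edge n})].

Definition uniform_prob (R : realType) (T : finType) (P : T -> Prop) : R :=
  #|[set t : T | `[< P t >]]|%:R / #|T|%:R.

(* [None] is the pseudo root. *)
Definition augment (n : nat) (G : rel 'I_n) : rel (option 'I_n) :=
  fun x y => match x, y with
             | Some u, Some v => G u v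
             | None, None => false
             | _, _ => true
             end.

(* The transcript of a traversal, most recent discovery first: [(v, A, w)]
   records that, with [A] the set of the unvisited neighbours of the current
   vertex [v], the traversal moved on to [w]. *)
Definition transcript (V : finType) : Type := seq (V * {set V} * V).

(* How a traversal selects the next vertex among the unvisited neighbours of
   the current one.  The selection may depend on everything seen so far, but not
   on the part of the graph that is still unexplored; reading each neighbourhood
   in the order of a fixed adjacency list is a special case. *)
Definition dfs_rule (V : finType) : Type :=
  transcript V -> V -> {set V} -> V.

Definition valid_rule (V : finType) (pick : dfs_rule V) : Prop :=
  forall (h : transcript V) (v : V) (A : {set V}), A != set0 -> pick h v A \in A.

Definition visited (V : finType) (s : V) (h : transcript V) : seq V :=
  s :: [seq x.2 | x <- h].

Definition dfs_step (V : finType) (e : rel V) (s : V) (pick : dfs_rule V)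
    (st : seq V * transcript V) : seq V * transcript V :=
  let: (stack, h) := st in
  if stack is v :: stack' then
    let A := [set w | e v w & w \notin visited s h] in
    if A == set0 then (stack', h)
    else let w := pick h v A in (w :: stack, (v, A, w) :: h)
  else st.

(* Every vertex is pushed and popped at most once, so that the stack is empty
   after [2 * #|V|] steps. *)
Definition dfs (V : finType) (e : rel V) (s : V) (pick : dfs_rule V) :
    transcript V :=
  (iter (#|V|.*2) (dfs_step e s pick) ([:: s], [::])).2.

(* [dfs_tree e s pick v w]: [v] is the parent of [w]. *)
Definition dfs_tree (V : finType) (e : rel V) (s : V) (pick : dfs_rule V) :
    rel V :=
  fun v w => (v, w) \in [seq (x.1.1, x.2) | x <- dfs e s pick].

(* The path is [s :: p], so that its length is [size p].  Its last vertex too is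
   required to have exactly one child. *)
Definition is_stick (V : finType) (T : rel V) (s : V) (p : seq V) : bool :=
  path T s p && all (fun v => #|[set w | T v w]| == 1%N) (s :: p).

(* Main.v *)
(* Run the traversal on the edge set [S] as an adaptive exploration: from the
   current vertex it asks for the pairs joining this vertex to the unvisited ones.
   [S] is a uniform [m]-subset of the [N] pairs, so whatever the exploration has
   seen, the probability that it ever designates [d] pairs not yet asked that are
   all absent is at most [C(N - d, m) / C(N, m) <= exp (- d m / N)].
   Let [u] be the floor of [n / 2^i] and [k = n - u].  The stick has length [k]
   unless the traversal gets stuck at one of its first [k] vertices ([d >= u]), or
   the graph induced on the [u] vertices still unvisited after [k] of them has an
   empty cut with parts of sizes [a] and [u - a] ([d = a (u - a)]).  Since
   [u m / N >= 2 ln n - 3], the union bound over these events is [O(1 / n)].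
   Connectedness is needed only for that last induced graph: if it holds, the
   traversal exhausts it before coming back to any vertex of the path. *)
Require Import Defs.
From HB Require Import structures.
From mathcomp Require Import all_boot all_order all_algebra fingroup perm.
From mathcomp Require Import boolp reals sequences exp.
From mathcomp Require Import zify ring lra.

Set Implicit Arguments.
Unset Strict Implicit.
Unset Printing Implicit Defensive.

Import Order.TTheory GRing.Theory Num.Theory.
Local Open Scope ring_scope.

(** * Adaptive queries to a uniformly random subset *)

Section AdaptiveExploration.

Variables (E : finType) (X : Type) (query : X -> {set E})
  (step : X -> {set E} -> X).

Fixpoint explore (x : X) (S : {set E}) (t : nat) : X :=
  if t is t'.+1 then explore (step x (S :&: query x)) S t' else x.

Fixpoint asked (x : X) (S : {set E}) (t : nat) : {set E} :=
  if t is t'.+1 then query x :|: asked (step x (S :&: query x)) S t' else set0.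

(** The recursions peel off the first query, as the induction on its answer requires; this lemma and
    the next peel off the last one, to match the iteration in [dfs]. *)
Lemma exploreS x S t :
  explore x S t.+1 = step (explore x S t) (S :&: query (explore x S t)).
Proof. by elim: t x => [//|t IH] x; rewrite [LHS]/= -IH. Qed.

Lemma askedS x S t : asked x S t.+1 = asked x S t :|: query (explore x S t).
Proof.
by elim: t x => [|t IH] x; rewrite [LHS]/= ?setU0 ?set0U // -setUA -IH.
Qed.

Variable target : X -> {set E}.

Definition misses (x : X) (t d : nat) (S : {set E}) : bool :=
  [&& d <= #|target (explore x S t)|,
      [disjoint target (explore x S t) & asked x S t] &
      [disjoint target (explore x S t) & S]]%N.

Lemma card_draws_le (F : {set E}) (k c : nat) (P : pred {set E}) (D : {set E}) :
  (forall T : {set E}, T \subset F -> #|T| = k -> P T -> [disjoint D & T]) ->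
  (#|F :\: D| <= c)%N ->
  (#|[set T : {set E} | [&& T \subset F, #|T| == k & P T]]| <= 'C(c, k))%N.
Proof.
move=> HP leFc; apply: leq_trans (leq_bin2l k leFc).
rewrite -cards_draws; apply/subset_leq_card/subsetP => T.
rewrite !inE => /and3P[TF /eqP Tk PT]; rewrite Tk eqxx andbT subsetD TF /=.
by rewrite disjoint_sym HP.
Qed.

Lemma sum_draws (A : {set E}) (k l : nat) :
  (\sum_(B : {set E} | (B \subset A) && (#|B| <= k)) 'C(l, k - #|B|) =
   'C(#|A| + l, k))%N.
Proof.
rewrite -binomial.Vandermonde.
rewrite (partition_big (fun B : {set E} => inord #|B| : 'I_k.+1) predT) //=.
apply: eq_bigr => j _; rewrite -cards_draws.
rewrite (eq_bigr (fun=> 'C(l, k - j))%N) => [|B /andP[/andP[_ lek] /eqP<-]]; last first.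
  by rewrite inordK.
rewrite sum_nat_const; congr (_ * _)%N; apply: eq_card => B.
rewrite !inE [in LHS]unfold_in -andbA; congr andb; have [lek|gtk] := leqP #|B| k => /=.
  by rewrite -(inj_eq val_inj) /= inordK.
by apply/esym/eqP => E1; move: gtk; rewrite E1 ltnNge -ltnS ltn_ord.
Qed.

(* Splitting according to the answer [T :&: query x] to the first query, the
   bounds for the possible answers add up by Vandermonde's identity. *)
Lemma card_misses_from (t d k : nat) (x : X) (F R : {set E}) :
  (#|[set T : {set E} | [&& T \subset F, #|T| == k &
      misses x t d (R :|: T) &&
      (target (explore x (R :|: T) t) \subset F)]]| <= 'C(#|F| - d, k))%N.
Proof.
(* In the induction [F] holds the elements still undecided, [R] those already found present, and [T]
   is the unknown part of the random set. *)
elim: t x k F R => [|t IH] x k F R.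
  have [/andP[leD DF]|nD] := boolP ((d <= #|target x|)%N && (target x \subset F)).
    apply: (@card_draws_le _ _ _ _ (target x)) => [T _ _ /andP[/and3P[_ _ +] _]|].
      by rewrite /= -!setI_eq0 setIUr setU_eq0 => /andP[].
    rewrite cardsD (setIidPr DF); exact: leq_sub2l.
  rewrite eq_card0 // => T; rewrite !inE /misses /=.
  by case: (d <= _)%N nD; case: (_ \subset F); rewrite ?andbF ?andFb.
set q := query x :&: F; set F' := F :\: query x.
have cF : (#|F| = #|q| + #|F'|)%N by rewrite /F' /q setIC cardsID.
have [led|gtd] := leqP d #|F'|; last first.
  rewrite eq_card0 // => T; rewrite !inE /misses /=; apply/negbTE/negP.
  case/and4P=> _ _ /and3P[led]; rewrite -setI_eq0 setIUr setU_eq0 setI_eq0.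
  case/andP=> dq _ _ DF; move: gtd; rewrite ltnNge => /negP; apply.
  by apply: leq_trans led _; apply: subset_leq_card; rewrite subsetD DF.
rewrite cF -addnBA // -sum_draws -sum1dep_card.
rewrite (partition_big (fun T : {set E} => T :&: q)
  (fun B : {set E} => (B \subset q) && (#|B| <= k)%N)) /=; last first.
  move=> T /and3P[_ /eqP<- _]; rewrite subsetIr /=.
  by apply: subset_leq_card; exact: subsetIl.
apply: leq_sum => B /andP[Bq lek].
have := IH (step x ((R :|: B) :&: query x)) (k - #|B|)%N F' (R :|: B).
apply: leq_trans; rewrite sum1dep_card.
(* On the fibre of [B] the part of [T] inside the query is fixed, so deleting it is injective. *)
rewrite -[leqLHS](card_in_imset (f := fun T : {set E} => T :\: query x)) => [|T1 T2]; last first.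
  rewrite !inE => /andP[/and3P[TF1 _ _] /eqP TB1] /andP[/and3P[TF2 _ _] /eqP TB2] eqT.
  rewrite -(setID T1 (query x)) -(setID T2 (query x)) eqT; congr (_ :|: _).
  by rewrite -(setIidPl TF1) -(setIidPl TF2) -!setIA ![F :&: _]setIC TB1 TB2.
apply/subset_leq_card/subsetP => _ /imsetP[T + ->].
rewrite !inE => /andP[/and4P[TF /eqP Tk mT DF] /eqP TB].
have TqB : T :&: query x = B by rewrite -TB /q [query x :&: F]setIC setIA (setIidPl TF).
have ET : R :|: B :|: T :\: query x = R :|: T by rewrite -setUA -TqB setID.
(* The first answer depends on [T] only through [B], so the whole fibre continues from one common
   state. *)
have Eq : (R :|: B) :&: query x = (R :|: T) :&: query x.
  by rewrite !setIUl -TqB -setIA setIid.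
rewrite setSD //= cardsD TqB Tk eqxx /= Eq ET.
move: mT DF; rewrite /misses /= => /and3P[-> + ->] DF.
rewrite -!setI_eq0 setIUr setU_eq0 !setI_eq0 => /andP[Dq ->] /=.
by rewrite subsetD DF.
Qed.

Lemma card_misses (t d m : nat) (x : X) :
  (#|[set S : {set E} | (#|S| == m) && misses x t d S]| <= 'C(#|E| - d, m))%N.
Proof.
have := @card_misses_from t d m x setT set0.
rewrite cardsT; apply: leq_trans; apply/subset_leq_card/subsetP => S.
by rewrite !inE set0U !subsetT => /andP[-> ->].
Qed.

End AdaptiveExploration.

(** Passing from [m] to [m + 1] multiplies the ratio of the binomials by [(N - d - m) / (N - m)],
    which is at most [(N - d) / N]. *)
Lemma bin_ratio (N d m : nat) :
  ('C(N - d, m) * N ^ m <= 'C(N, m) * (N - d) ^ m)%N.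
Proof.
elim: m => [|m IH]; first by rewrite !bin0 !expn0.
rewrite -(leq_pmul2r (ltn0Sn m)) !expnSr.
have E1 : ('C(N - d, m.+1) * (N ^ m * N) * m.+1 =
  ('C(N - d, m) * N ^ m) * ((N - d - m) * N))%N.
  transitivity ((m.+1 * 'C(N - d, m.+1)) * (N ^ m * N))%N; first by ring.
  by rewrite mul_bin_left; ring.
have E2 : ('C(N, m.+1) * ((N - d) ^ m * (N - d)) * m.+1 =
  ('C(N, m) * (N - d) ^ m) * ((N - m) * (N - d)))%N.
  transitivity ((m.+1 * 'C(N, m.+1)) * ((N - d) ^ m * (N - d)))%N; first by ring.
  by rewrite mul_bin_left; ring.
rewrite E1 E2; apply: leq_mul => //; rewrite -!subnDA.
have [leNd|] := leqP N (d + m); first by have -> : (N - (d + m) = 0)%N by lia.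
move=> ltN; rewrite -(subnKC (ltnW ltN)); set a := (N - (d + m))%N.
rewrite (_ : (d + m + a - (d + m)) = a)%N; last by lia.
rewrite (_ : (d + m + a - m) = d + a)%N; last by lia.
by rewrite (_ : (d + m + a - d) = m + a)%N; [nia|lia].
Qed.

(** * From random permutations to uniform subsets *)

Section RandomPrefix.

Variable E : finType.

Definition prefix_set (m : nat) (sigma : {perm E}) : {set E} :=
  [set sigma e | e in take m (enum E)].

(** List each set followed by its complement, and match the entries of the two lists by position. *)
Lemma perm_set_transitive (S T : {set E}) :
  #|S| = #|T| -> exists p : {perm E}, p @: S = T.
Proof.
move=> eqST; pose l (A : {set E}) := enum A ++ enum (~: A).
have ul A : uniq (l A).
  rewrite cat_uniq !enum_uniq andbT /=; apply/hasPn => x.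
  by rewrite !mem_enum inE.
have inl A x : x \in l A by rewrite mem_cat !mem_enum inE orbN.
have sl A : size (l A) = #|E| by rewrite size_cat -!cardE cardsC.
have ltl A B x : (index x (l A) < size (l B))%N by rewrite sl -(sl A) index_mem.
pose f x := nth x (l T) (index x (l S)).
have fI : injective f.
  move=> x y; rewrite /f (set_nth_default y) // => /eqP.
  rewrite nth_uniq // => /eqP eqi.
  by rewrite -(nth_index x (inl S x)) eqi nth_index.
exists (perm fI); apply/eqP; rewrite eqEcard card_imset; last exact: perm_inj.
rewrite eqST leqnn andbT; apply/subsetP => _ /imsetP[x xS ->].
have ltx : (index x (enum S) < size (enum T))%N.
  by rewrite -cardE -eqST cardE index_mem mem_enum.
rewrite permE /f /l index_cat mem_enum xS nth_cat ltx.
by rewrite -mem_enum mem_nth.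
Qed.

Lemma card_prefix_set (m : nat) (sigma : {perm E}) :
  (m <= #|E|)%N -> #|prefix_set m sigma| = m.
Proof.
move=> lem; rewrite card_imset; last exact: perm_inj.
have /card_uniqP -> := take_uniq m (enum_uniq E).
by rewrite size_takel // -cardE.
Qed.

(** Composing with a permutation that carries [S] to [T] maps one fibre bijectively onto the
    other. *)
Lemma card_prefix_fibre (m : nat) (S T : {set E}) : #|S| = #|T| ->
  #|[set s | prefix_set m s == S]| = #|[set s | prefix_set m s == T]|.
Proof.
move=> /perm_set_transitive[p <-].
rewrite -[LHS](card_imset _ (mulIg p)); apply: eq_card => s.
have imp (r : {perm E}) : prefix_set m (r * p)%g = p @: prefix_set m r.
  by rewrite -imset_comp; apply: eq_imset => e; rewrite /= permM.
rewrite inE; apply/imsetP/eqP => [[r + ->]|eqs].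
  by rewrite inE imp => /eqP ->.
exists (s * p^-1)%g; last by rewrite mulgVK.
by rewrite inE; apply/eqP/(imset_inj (@perm_inj _ p)); rewrite -imp mulgVK.
Qed.

(** Uniformity of the prefix on the [m]-subsets, cross-multiplied to stay in [nat]: all fibres have
    the same size [f]. *)
Lemma card_prefix_pred (m : nat) (P : pred {set E}) : (m <= #|E|)%N ->
  (#|[set s : {perm E} | P (prefix_set m s)]| * 'C(#|E|, m) =
   #|[set S : {set E} | (#|S| == m) && P S]| * #|{perm E}|)%N.
Proof.
move=> lem; have [A0 cA0] : exists A : {set E}, #|A| = m.
  exists (prefix_set m 1%g); exact: card_prefix_set.
pose f := #|[set s | prefix_set m s == A0]|.
have count (Q : pred {set E}) :
    (#|[set s : {perm E} | Q (prefix_set m s)]| =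
     #|[set S : {set E} | (#|S| == m) && Q S]| * f)%N.
  rewrite -sum1dep_card (partition_big (prefix_set m)
    (fun S : {set E} => (#|S| == m) && Q S)) /= => [|s ->]; last first.
    by rewrite card_prefix_set // eqxx.
  rewrite -[in RHS]sum1dep_card big_distrl /=; apply: eq_bigr => S /andP[/eqP cS QS].
  rewrite mul1n /f -(@card_prefix_fibre m S) ?cS // sum1dep_card.
  apply: eq_card => s; rewrite !inE andb_idl // => /eqP -> //.
have -> : #|{perm E}| = ('C(#|E|, m) * f)%N.
  transitivity #|[set s : {perm E} | predT (prefix_set m s)]|.
    by rewrite -cardsT; apply: eq_card => s; rewrite !inE.
  rewrite count -card_draws; congr (_ * _)%N.
  by apply: eq_card => S; rewrite !inE andbT.
by rewrite count -mulnA [(f * _)%N]mulnC.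
Qed.

End RandomPrefix.

Lemma map_uniq_in_inj (T1 T2 : eqType) (f : T1 -> T2) (l : seq T1) :
  uniq (map f l) -> {in l &, injective f}.
Proof.
move=> uf x y xl yl eqf; have sx := xl; have sy := yl.
rewrite -index_mem in sx; rewrite -index_mem in sy.
rewrite -(nth_index x xl) -(nth_index x yl); congr (nth x l _).
apply: (uniqP (f x) uf); rewrite ?inE ?size_map //.
by rewrite !(nth_map x) // !nth_index.
Qed.

(** * Depth-first search: the initial descent and what follows it *)

Section DepthFirstSearch.

Variables (V : finType) (e : rel V) (s : V) (pick : dfs_rule V).
Hypothesis pickP : valid_rule pick.

Definition dfs_state (k : nat) : seq V * transcript V :=
  iter k (dfs_step e s pick) ([:: s], [::]).

Definition unvisited (h : transcript V) : {set V} :=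
  [set w | w \notin visited s h].

(** The stack starts with one vertex and gains at most one per step, so this size says that each of
    the first [k] steps discovered a vertex. *)
Definition descended (k : nat) : Prop := size (dfs_state k).1 = k.+1.

Lemma dfs_stateS k : dfs_state k.+1 = dfs_step e s pick (dfs_state k).
Proof. by []. Qed.

Lemma dfs_state_size k : (size (dfs_state k).1 <= k.+1)%N.
Proof.
elim: k => [//|k]; rewrite /dfs_state iterS.
case: (iter _ _ _) => [[|v st] h] //=; case: ifP => //= _; lia.
Qed.

Lemma descendedW k : descended k.+1 -> descended k.
Proof.
have := dfs_state_size k; rewrite /descended /dfs_state iterS.
case: (iter _ _ _) => [[|v st] h] //=; case: ifP => //= _; lia.
Qed.

(** The last clause holds because a vertex is popped only when all its neighbours are visited, and
    visited vertices stay visited. *)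
Lemma dfs_state_inv k :
  [/\ uniq (visited s (dfs_state k).2),
      {subset (dfs_state k).1 <= visited s (dfs_state k).2} &
      forall v w, v \in visited s (dfs_state k).2 ->
        v \notin (dfs_state k).1 -> e v w -> w \in visited s (dfs_state k).2].
Proof.
elim: k => [|k]; first by split=> // v w /= -> .
rewrite /dfs_state iterS; case: (iter _ _ _) => [[|v st] h] //= [uh sub clo].
case: ifP => [/eqP A0|/negbT An0] /=.
  split=> // [x xst|x w xh xst exw]; first by apply: sub; rewrite inE xst orbT.
  have [eqx|nx] := eqVneq x v; last by apply: (clo x); rewrite // inE negb_or nx.
  move/setP/(_ w): A0; rewrite !inE -eqx exw /=.
  exact: negbFE.
set w := pick _ _ _; have := pickP h v An0; rewrite -/w inE => /andP[_ wh].
split.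
- move: wh uh; rewrite !inE !negb_or => /andP[nws ->] /andP[-> ->].
  by rewrite eq_sym nws.
- move=> x; rewrite !inE => /orP[/eqP->|xst]; first by rewrite eqxx orbT.
  by have := sub x; rewrite !inE => /(_ xst) /orP[]->; rewrite ?orbT.
- move=> x y; rewrite !inE negb_or => xh /andP[xw xst] exy.
  have := clo x y; rewrite !inE => /(_ _ _ exy) H.
  have : (y == s) || (y \in [seq z.2 | z <- h]).
    by apply: H => //; move: xh; rewrite (negbTE xw).
  by case/orP=> ->; rewrite ?orbT.
Qed.

(** With nothing popped yet, each discovery is made from the vertex discovered just before, so the
    tree so far is a path. *)
Lemma descended_state k : descended k ->
  let: (st, h) := dfs_state k in
  [/\ st = rcons [seq x.2 | x <- h] s, [seq x.1.1 | x <- h] = behead st,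
      size h = k &
      path (fun v w => (v, w) \in [seq (x.1.1, x.2) | x <- h]) s
        (rev [seq x.2 | x <- h])].
Proof.
elim: k => [//|k IH] dk; have := IH (descendedW dk).
move: dk (descendedW dk); rewrite /descended /dfs_state iterS.
case: (iter _ _ _) => [[|v st] h] //=; case: ifP => //= _; first by lia.
move=> _ _ [est epar sz pth]; split=> //; rewrite ?sz -?est ?epar //.
rewrite rev_cons rcons_path; apply/andP; split.
  by apply: sub_path pth => x y; rewrite inE orbC => ->.
rewrite inE; apply/orP; left; apply/eqP; congr (_, _).
by case: {pth epar sz} h est => [|y h] [-> _] //=; rewrite rev_cons last_rcons.
Qed.

Lemma descended_setC k : descended k ->
  uniq (dfs_state k).1 /\
  unvisited (dfs_state k).2 = [set w | w \notin (dfs_state k).1].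
Proof.
move=> dk; have [un _ _] := dfs_state_inv k; move: un (descended_state dk).
case: (dfs_state k) => st h /= un [-> _ _ _].
split; first by rewrite rcons_uniq.
by apply/setP => w; rewrite !inE mem_rcons inE.
Qed.

Lemma descended_push k : descended k.+1 ->
  exists2 w, w \in unvisited (dfs_state k).2 &
    (dfs_state k.+1).1 = w :: (dfs_state k).1.
Proof.
move=> dk1; move: dk1 (descendedW dk1); rewrite /descended /dfs_state iterS.
case: (iter _ _ _) => [[|v st] h] //=; case: ifP => /= [_|/negbT An0 _ _]; first by lia.
by eexists; last by []; have := pickP h v An0; rewrite !inE => /andP[].
Qed.

Lemma visited_dfs_state_mono j k : (j <= k)%N ->
  {subset visited s (dfs_state j).2 <= visited s (dfs_state k).2}.
Proof.
elim: k => [|k IH]; first by rewrite leqn0 => /eqP->.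
rewrite leq_eqVlt => /predU1P[->//|/IH H] x /H.
rewrite /dfs_state iterS; case: (iter k _ _) => [[|v st] h] //=.
by case: ifP => //= _; rewrite !inE => /orP[]->; rewrite ?orbT.
Qed.

(* Once the traversal has left the current path for the unvisited part, it comes
   back to that path only after having exhausted this part, as the latter has no
   empty cut. *)
Lemma dfs_after_descent k j : descended k.+1 ->
  (forall W : {set V}, W != set0 -> W \proper unvisited (dfs_state k).2 ->
    exists x y, [/\ x \in W, y \in unvisited (dfs_state k).2 :\: W & e x y]) ->
  exists h, [/\ (dfs_state (k.+1 + j)).2 = h ++ (dfs_state k.+1).2,
    {in h, forall x, x.1.1 \notin (dfs_state k).1} &
    (exists2 rest, (dfs_state (k.+1 + j)).1 = rest ++ (dfs_state k).1 &
      {in rest, forall v, v \notin (dfs_state k).1}) \/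
    unvisited (dfs_state (k.+1 + j)).2 = set0].
Proof.
move=> dk1 conn; have [w0 w0U Ew0] := descended_push dk1.
have [_ U_base] := descended_setC (descendedW dk1).
have nbase x : (x \notin (dfs_state k).1) = (x \in unvisited (dfs_state k).2).
  by rewrite U_base inE.
elim: j => [|j [h [Eh hbase IH]]].
  exists [::]; rewrite addn0; split=> //; left; rewrite Ew0; exists [:: w0] => //.
  by move=> x; rewrite inE => /eqP ->; rewrite nbase.
have [_ sub clo] := dfs_state_inv (k.+1 + j).
have exhausted : unvisited (dfs_state (k.+1 + j)).2 = set0 ->
    (dfs_state (k.+1 + j.+1)).2 = (dfs_state (k.+1 + j)).2.
  rewrite addnS /dfs_state iterS; case: (iter _ _ _) => [[|v st] h'] //=.
  move/setP=> U0; case: ifP => //= /negbT /set0Pn[w].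
  by rewrite inE => /andP[_ wU]; have := U0 w; rewrite !inE wU.
case: IH => [[[|v rest] Est rest_base]|U0]; last first.
- by exists h; rewrite exhausted //; split=> //; right.
- have vbase : v \notin (dfs_state k).1 by apply: rest_base; rewrite mem_head.
  have rest_base' : {in rest, forall x, x \notin (dfs_state k).1}.
    by move=> x xr; apply: rest_base; rewrite inE xr orbT.
  have mono := @visited_dfs_state_mono k (k.+1 + j) (leq_trans (leqnSn k) (leq_addr _ _)).
  move: Est Eh mono; rewrite addnS (dfs_stateS (k.+1 + j)).
  case: (dfs_state (k.+1 + j)) => st h' /= -> -> mono /=.
  case: ifP => [_|/negbT An0] /=; first by exists h; split=> //; left; exists rest.
  set w := pick _ _ _; have := pickP (h ++ (dfs_state k.+1).2) v An0.
  rewrite -/w inE => /andP[_ wU]; eexists (_ :: h); split; first by [].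
    by move=> x; rewrite inE => /predU1P[->|/hbase].
  left; exists (w :: v :: rest) => // x; rewrite inE => /predU1P[->|/rest_base//].
  by rewrite nbase inE; apply: contra wU => /mono.
(* The stack is back to the path. The vertices visited since the descent have left the stack, so all
   their neighbours are visited; if some vertex were still unvisited, they would be one side of an
   empty cut. *)
- suff U0 : unvisited (dfs_state (k.+1 + j)).2 = set0.
    by exists h; rewrite exhausted //; split=> //; right.
  have monoU : unvisited (dfs_state (k.+1 + j)).2 \subset unvisited (dfs_state k).2.
    apply/subsetP => x; rewrite !inE; apply: contra.
    exact: (visited_dfs_state_mono (leq_trans (leqnSn k) (leq_addr _ _))).
  apply/eqP/negPn/negP => Un0.
  case: (conn (unvisited (dfs_state k).2 :\: unvisited (dfs_state (k.+1 + j)).2)).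
  + apply/set0Pn; exists w0; rewrite inE w0U andbT !inE negbK.
    apply: (visited_dfs_state_mono (leq_addr j k.+1)).
    by have [_ H _] := dfs_state_inv k.+1; apply: H; rewrite Ew0 mem_head.
  + rewrite properEneq subsetDl andbT; apply: contra Un0 => /eqP/setDidPl.
    by rewrite disjoint_sym -setI_eq0 (setIidPl monoU).
  + move=> x [y [+ + exy]]; rewrite !in_setD -!nbase.
    move=> /andP[xv xb] /andP[+ yb]; rewrite yb andbT negbK.
    move: xv; rewrite !inE negbK => xv /negP; apply.
    by apply: clo xv _ exy; rewrite Est.
Qed.

(** Discovery [k + 1] gives the last vertex of the path its child. Later discoveries have their
    parents off the path, so no path vertex gets a second child. *)
Lemma dfs_stick k : (k < #|V|.*2)%N -> descended k.+1 ->
  (forall W : {set V}, W != set0 -> W \proper unvisited (dfs_state k).2 ->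
    exists x y, [/\ x \in W, y \in unvisited (dfs_state k).2 :\: W & e x y]) ->
  exists2 p, is_stick (dfs_tree e s pick) s p & size p = k.
Proof.
move=> ltk dk1 conn.
have [h [Eh hbase _]] := dfs_after_descent (#|V|.*2 - k.+1) dk1 conn.
rewrite subnKC // in Eh.
have ET v w : dfs_tree e s pick v w =
    ((v, w) \in [seq (x.1.1, x.2) | x <- h ++ (dfs_state k.+1).2]).
  by rewrite -Eh.
have dk := descendedW dk1; have [uniq_st _] := descended_setC dk.
have [w0 _ Ew0] := descended_push dk1.
move: (descended_state dk1) (descended_state dk) uniq_st Ew0 hbase ET.
have : exists x, (dfs_state k.+1).2 = x :: (dfs_state k).2.
  move: dk1 dk; rewrite /descended /dfs_state iterS.
  by case: (iter _ _ _) => [[|v st] h'] //=; case: ifP => /= _; [lia|eexists].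
case: (dfs_state k.+1) => st1 h1; case: (dfs_state k) => st0 h0 /= [x0 ->].
move=> [_ epar _ _] [est0 _ sz0 pth] ust0 est1 hbase ET.
exists (rev [seq x.2 | x <- h0]); last by rewrite size_rev size_map.
apply/andP; split.
  apply: sub_path pth => v w vw; rewrite ET map_cat mem_cat; apply/orP; right.
  by rewrite inE vw orbT.
apply/allP => v; rewrite -rev_rcons -est0 mem_rev => v_st0.
have := v_st0; rewrite -[st0]/(behead (w0 :: st0)) -est1 -epar => /mapP[y yh ev].
apply/cards1P; exists y.2; apply/setP => w; rewrite !inE ET map_cat mem_cat.
apply/orP/eqP => [[/mapP[z /hbase zb [vz _]]|/mapP[z zh [vz ->]]]|->].
- by rewrite -vz v_st0 in zb.
- suff -> : z = y by [].
  (* The parents in the first [k + 1] discoveries are the stack entries after [k] steps, each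
     occurring once. *)
  have upar : uniq [seq x.1.1 | x <- x0 :: h0] by rewrite epar est1.
  by apply: (map_uniq_in_inj upar) => //; rewrite -vz -ev.
- by right; rewrite ev; apply/mapP; exists y.
Qed.

End DepthFirstSearch.

Lemma card_bigcup_le (I T : finType) (P : pred I) (F : I -> {set T}) :
  (#|\bigcup_(i | P i) F i| <= \sum_(i | P i) #|F i|)%N.
Proof.
elim/big_rec2: _ => [|i k A _ leAk]; first by rewrite cards0.
by apply: leq_trans (leq_card_setU _ _) _; rewrite leq_add2l.
Qed.

(** * The traversal as an exploration of the edge set *)

Section EdgeExposure.

Variable n : nat.

Definition edge_graph (S : {set edge n}) : rel 'I_n :=
  fun u v => [set u; v] \in val @: S.

Definition cut (A B : {set 'I_n}) : {set edge n} :=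
  [set e | [exists x in A, [exists y in B, val e == [set x; y]]]].

Lemma edge_graph_sym (S : {set edge n}) : symmetric (edge_graph S).
Proof. by move=> x y; rewrite /edge_graph setUC. Qed.

Lemma cutP (A B : {set 'I_n}) (e : edge n) :
  reflect (exists x y, [/\ x \in A, y \in B & val e = [set x; y]]) (e \in cut A B).
Proof.
rewrite inE; apply: (iffP exists_inP) => [[x xA /exists_inP[y yB /eqP]]|].
  by exists x, y.
by case=> x [y [xA yB ee]]; exists x => //; apply/exists_inP; exists y => //; apply/eqP.
Qed.

Lemma card_edge : #|{: edge n}| = 'C(n, 2).
Proof.
rewrite card_sig -[in RHS](card_ord n) -card_draws.
by apply: eq_card => A; rewrite !inE.
Qed.

Lemma card_cut (A B : {set 'I_n}) :
  [disjoint A & B] -> (#|A| * #|B| <= #|cut A B|)%N.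
Proof.
move=> dAB; rewrite -cardsX -(card_imset _ val_inj).
pose f (p : 'I_n * 'I_n) := [set p.1; p.2].
have ne x y : x \in A -> y \in B -> x != y.
  move=> xA yB; apply: contraTneq xA => ->.
  by rewrite (disjointFl dAB yB).
rewrite -(@card_in_imset _ _ f) => [|[x y] [x' y']].
  apply/subset_leq_card/subsetP => _ /imsetP[[x y] + ->].
  rewrite inE => /andP[/= xA yB].
  have exy : #|f (x, y)| == 2%N by rewrite cards2 ne.
  apply/imsetP; exists (exist _ (f (x, y)) exy) => //.
  by apply/cutP; exists x, y.
rewrite !inE => /andP[/= xA yB] /andP[/= xA' yB'] /setP ef.
have := ef x; have := ef y; rewrite !inE !eqxx orbT /=.
move=> /esym/orP[/eqP Ey|/eqP->] /esym/orP[/eqP->|/eqP Ex] //.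
- by have := ne _ _ xA' yB; rewrite Ey eqxx.
- by have := ne _ _ xA' yB; rewrite Ey eqxx.
- by have := ne _ _ xA yB'; rewrite Ex eqxx.
Qed.

Lemma disjoint_cut (A B : {set 'I_n}) (S : {set edge n}) :
  {in A & B, forall x y, ~~ edge_graph S x y} -> [disjoint cut A B & S].
Proof.
move=> noAB; rewrite -setI_eq0; apply/eqP/setP => e; rewrite !in_setI in_set0.
apply/negP => /andP[/cutP[x [y [xA yB ee]]] eS].
by have /negP := noAB x y xA yB; apply; rewrite /edge_graph -ee imset_f.
Qed.

Variable pick : dfs_rule (option 'I_n).
Hypothesis pickP : valid_rule pick.

Let state : Type := seq (option 'I_n) * transcript (option 'I_n).

Definition free (st : state) : {set 'I_n} :=
  [set x | Some x \in unvisited None st.2].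

Lemma in_free st x : (x \in free st) = (Some x \notin visited None st.2).
Proof. by rewrite !in_set. Qed.

(** At the pseudo root nothing is asked, because its edges are present whatever [S] is. *)
Definition dfs_query (st : state) : {set edge n} :=
  if st.1 is Some v :: _ then cut [set v] (free st) else set0.

Definition dfs_update (st : state) (S : {set edge n}) : state :=
  dfs_step (augment (edge_graph S)) None pick st.

Definition dfs_start : state := ([:: None], [::]).

Local Notation run S := (dfs_state (augment (edge_graph S)) None pick).
Local Notation down S := (descended (augment (edge_graph S)) None pick).

(** A step reads only the edges from the current vertex to unvisited ones; this makes the traversal
    an instance of [explore]. *)
Lemma dfs_update_query st S :
  dfs_update st (S :&: dfs_query st) = dfs_update st S.
Proof.
case: st => [[|[v|] st] h] //; rewrite /dfs_update /dfs_step.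
suff -> : [set w | augment (edge_graph (S :&: dfs_query (Some v :: st, h))) (Some v) w
             & w \notin visited None h] =
          [set w | augment (edge_graph S) (Some v) w & w \notin visited None h] by [].
apply/setP => -[y|]; rewrite !inE //=.
have [yh|] := boolP (_ \notin _); last by rewrite !andbF.
congr andb; apply/imsetP/imsetP => -[e + ee]; rewrite ?inE.
  by case/andP=> eS _; exists e.
move=> eS; exists e; rewrite // !inE eS /=.
by apply/exists_inP; exists v; rewrite ?inE //; apply/exists_inP; exists y; rewrite ?ee ?inE.
Qed.

Lemma explore_dfs S k : explore dfs_query dfs_update dfs_start S k = run S k.
Proof.
by elim: k => [//|k IH]; rewrite exploreS IH dfs_update_query dfs_stateS.
Qed.

(** During the descent an asked pair contains a former current vertex, which now lies strictly below
    the top of the stack; the top itself has not asked yet. *)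
Lemma asked_dfs S t e : down S t ->
  e \in asked dfs_query dfs_update dfs_start S t ->
  exists2 x, x \in val e & Some x \in behead (run S t).1.
Proof.
elim: t => [|t IH] dt; first by rewrite inE.
have [w _ Ew] := descended_push pickP dt.
rewrite askedS Ew inE explore_dfs => /orP[/(IH (descendedW dt))[x xe xt]|].
  by exists x => //; exact: mem_behead.
rewrite /dfs_query; case: (run S t).1 => [|[v|] st]; rewrite ?inE //.
case/exists_inP=> x; rewrite inE => /eqP -> /exists_inP[y _ /eqP ee].
by exists v; rewrite ?mem_head // ee !inE eqxx.
Qed.

Lemma card_free S t : down S t -> #|free (run S t)| = (n - t)%N.
Proof.
move=> dt; have [un _ _] := dfs_state_inv (augment (edge_graph S)) None pickP t.
have := descended_state dt; rewrite /free; move: un.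
case: (run S t) => st h /= un [_ _ sz _].
have SomeI : injective (@Some 'I_n) by move=> x y [].
have -> : #|[set x : 'I_n | Some x \in unvisited None h]| = #|unvisited None h|.
  rewrite -(card_imset _ SomeI); apply: eq_card => -[y|].
    by rewrite (mem_imset _ _ SomeI) inE.
  rewrite !inE /=; apply/imsetP => -[x _]; discriminate.
have := cardsC (unvisited None h); rewrite card_option card_ord.
suff -> : #|~: unvisited None h| = t.+1 by lia.
have {}un : uniq (visited None h) := un.
rewrite -sz -(size_map snd) -[RHS]/(size (visited None h)) -(card_uniqP un).
by apply: eq_card => y; rewrite !inE negbK.
Qed.

Lemma descended_top S t : (0 < t)%N -> down S t ->
  exists2 v, exists st, (run S t).1 = Some v :: st & v \notin free (run S t).
Proof.
move=> t_gt0 dt; have [_ sub _] := dfs_state_inv (augment (edge_graph S)) None pickP t.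
have [uniq_st _] := descended_setC pickP dt.
move: sub uniq_st (descended_state dt).
case: (run S t) => st [|[[a A] v] h] /= sub uniq_st [est _ sz _].
  by rewrite -sz in t_gt0.
case: v sub uniq_st est => [v|] sub uniq_st est /=; last first.
  by move: uniq_st; rewrite est /= mem_rcons mem_head.
exists v; first by exists (rcons [seq x.2 | x <- h] None).
by rewrite in_free negbK sub // est mem_head.
Qed.

(** A failed descent means that the top vertex has no edge to the [n - t] free ones. None of these
    pairs was asked, since an asked pair contains a vertex below the top, which is neither the top
    nor free. *)
Lemma stuck_misses S t u : (0 < t)%N -> (u <= n - t)%N -> down S t -> ~ down S t.+1 ->
  misses dfs_query dfs_update dfs_query dfs_start t u S.
Proof.
move=> t_gt0 leu dt ndt; have [v [st Est] vfree] := descended_top t_gt0 dt.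
have [_ sub _] := dfs_state_inv (augment (edge_graph S)) None pickP t.
have [uniq_st _] := descended_setC pickP dt.
have eq_q : dfs_query (run S t) = cut [set v] (free (run S t)).
  by rewrite /dfs_query Est.
rewrite /misses explore_dfs eq_q; apply/and3P; split.
- apply: leq_trans (card_cut _); last by rewrite disjoints1.
  by rewrite cards1 mul1n card_free.
- rewrite -setI_eq0; apply/eqP/setP => e; rewrite !in_setI in_set0.
  apply/negP => /andP[/cutP[x [y [/set1P-> yfree ee]]] /(asked_dfs dt)[z]].
  rewrite ee Est /= !inE => /orP[/eqP->|/eqP->] zst.
    by move: uniq_st; rewrite Est /= zst.
  by move: yfree; rewrite in_free sub // Est inE zst orbT.
- apply: disjoint_cut => x y /set1P-> yfree; apply/negP => evy; apply: ndt.
  move: Est dt yfree; rewrite /descended dfs_stateS.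
  case: (run S t) => st' h /= -> /= dt; rewrite inE => yfree.
  case: eqP => [/setP/(_ (Some y))|_] /=; last by rewrite dt.
  by move: yfree; rewrite !inE /= evy => ->.
Qed.

(* Naming the parts of [A] by sets of ranks makes a union bound over the cuts of
   the unvisited part range over indices that do not depend on the graph. *)
Definition subset_at (u : nat) (I : {set 'I_u}) (A : {set 'I_n}) : {set 'I_n} :=
  [set x in A | [exists i in I, index x (enum A) == i :> nat]].

Lemma card_subset_at (A : {set 'I_n}) (u : nat) (I : {set 'I_u}) :
  #|A| = u -> #|subset_at I A| = #|I|.
Proof.
move=> cA; have [/eqP A0|/set0Pn[x0 x0A]] := boolP (A == set0).
  have u0 : u = 0%N by rewrite -cA A0 cards0.
  by move: I {cA}; rewrite u0 => I; rewrite A0 !eq_card0 // => [i|x]; [case: i|rewrite !inE].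
have szA : size (enum A) = u by rewrite -cA cardE.
pose f (i : 'I_u) := nth x0 (enum A) i.
have fI : injective f.
  move=> i j /eqP; rewrite nth_uniq ?szA ?enum_uniq // => /eqP; exact: val_inj.
rewrite -(card_imset _ fI); apply: eq_card => x; rewrite inE.
apply/andP/imsetP => [[xA /exists_inP[i iI /eqP ix]]|[i iI ->]].
  by exists i; rewrite // /f -ix nth_index // mem_enum.
rewrite -mem_enum mem_nth ?szA //; split=> //; apply/exists_inP; exists i => //.
by rewrite index_uniq ?szA ?enum_uniq.
Qed.

Lemma subset_at_surj (A B : {set 'I_n}) (u : nat) :
  #|A| = u -> B \subset A -> exists I : {set 'I_u}, subset_at I A = B.
Proof.
move=> cA BA; exists [set i : 'I_u | [exists x in B, index x (enum A) == i :> nat]].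
apply/setP => x; rewrite inE; apply/andP/idP => [[xA /exists_inP[i]]|xB].
  rewrite inE => /exists_inP[y yB /eqP <-] /eqP exy.
  suff -> : x = y by [].
  have yA : y \in enum A by rewrite mem_enum (subsetP BA).
  by rewrite -(nth_index x yA) -exy nth_index // mem_enum.
have xA := subsetP BA _ xB; split=> //.
have ltx : (index x (enum A) < u)%N by rewrite -cA cardE index_mem mem_enum.
apply/exists_inP; exists (Ordinal ltx) => //.
by rewrite inE; apply/exists_inP; exists x.
Qed.

Definition cut_target (u : nat) (I : {set 'I_u}) (st : state) : {set edge n} :=
  cut (subset_at I (free st)) (free st :\: subset_at I (free st)).

(** The pairs of the cut join two free vertices, whereas each asked pair contains a visited one. *)
Lemma cut_misses S k u (W : {set 'I_n}) : down S k -> u = (n - k)%N ->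
  W \subset free (run S k) ->
  {in W & free (run S k) :\: W, forall x y, ~~ edge_graph S x y} ->
  exists2 I : {set 'I_u}, #|I| = #|W| &
    misses dfs_query dfs_update (cut_target I) dfs_start k (#|I| * (u - #|I|)) S.
Proof.
move=> dk eu WF noW; have cF : #|free (run S k)| = u by rewrite card_free // eu.
have [I EI] := subset_at_surj cF WF.
have cI : #|I| = #|W| by rewrite -EI card_subset_at.
exists I; rewrite // /misses explore_dfs /cut_target EI; apply/and3P; split.
- apply: leq_trans (card_cut _); first by rewrite cI cardsD (setIidPr WF) cF.
  by rewrite -setI_eq0 setIDA setDIl setDv set0I.
- rewrite -setI_eq0; apply/eqP/setP => e; rewrite !in_setI in_set0.
  apply/negP => /andP[/cutP[x [y [xW /setDP[yF _] ee]]] /(asked_dfs dk)[z ze /mem_behead zst]].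
  have [_ sub _] := dfs_state_inv (augment (edge_graph S)) None pickP k.
  have zF : z \in free (run S k).
    by move: ze; rewrite ee => /set2P[->|->] //; exact: (subsetP WF).
  by move: zF; rewrite in_free sub.
- exact: disjoint_cut.
Qed.

(** Never getting stuck carries the descent through [n - u + 1] steps; the absence of empty cuts
    among the [u] vertices free after [n - u] steps is then what [dfs_stick] asks for. *)
Lemma stick_of_no_miss S u : (0 < u <= n)%N ->
  (forall t, (0 < t <= n - u)%N ->
    ~~ misses dfs_query dfs_update dfs_query dfs_start t u S) ->
  (forall I : {set 'I_u}, (0 < #|I|)%N -> (#|I|.*2 <= u)%N ->
    ~~ misses dfs_query dfs_update (cut_target I) dfs_start (n - u)
        (#|I| * (u - #|I|)) S) ->
  exists2 p, is_stick (dfs_tree (augment (edge_graph S)) None pick) None p &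
    size p = (n - u)%N.
Proof.
move=> /andP[u_gt0 leun] no_stuck no_cut; set k := (n - u)%N.
have dk1 : down S k.+1.
  suff H t : (t <= k.+1)%N -> down S t by apply: H.
  elim: t => [//|[|t] IH] lt; last first.
    apply/eqP/negPn/negP => /eqP nd; have /negP := no_stuck t.+1 lt; apply.
    by apply: stuck_misses => //; [lia|apply: IH; lia].
  (* The first step is certain to descend, as the pseudo root is adjacent to every vertex. *)
  rewrite /descended dfs_stateS /dfs_state /=; case: eqP => // /setP.
  have n_gt0 : (0 < n)%N by lia.
  by move=> /(_ (Some (Ordinal n_gt0))); rewrite !inE.
have dk := descendedW dk1.
apply: (dfs_stick pickP) dk1 _; first by rewrite card_option card_ord; lia.
have noneU : None \notin unvisited None (run S k).2 by rewrite !inE.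
move=> W /set0Pn[w wW] /properP[WU [w' w'U w'W]].
have [/exists_inP[x xW /exists_inP[y yU exy]]|noW] := boolP [exists x in W,
    [exists y in unvisited None (run S k).2 :\: W, augment (edge_graph S) x y]].
  by exists x, y.
have {}noW x y : x \in W -> y \in unvisited None (run S k).2 -> y \notin W ->
    ~~ augment (edge_graph S) x y.
  move=> xW yU yW; apply: contra noW => exy; apply/exists_inP; exists x => //.
  by apply/exists_inP; exists y; rewrite // !in_setD yW.
pose B := [set x | Some x \in W].
have BF : B \subset free (run S k).
  by apply/subsetP => x; rewrite !inE => /(subsetP WU); rewrite !inE.
have cF : #|free (run S k)| = u by rewrite card_free // /k; lia.
have eu : u = (n - k)%N by rewrite /k; lia.
have noB : {in B & free (run S k) :\: B, forall x y, ~~ edge_graph S x y}.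
  move=> x y xB /setDP[]; rewrite in_set => yU; move: xB; rewrite !in_set => xW yW.
  exact: (noW (Some x) (Some y) xW yU yW).
have B_gt0 : (0 < #|B|)%N.
  case: w wW => [w|] wW; last by rewrite (subsetP WU) in noneU.
  by apply/card_gt0P; exists w; rewrite inE.
have cFB : #|free (run S k) :\: B| = (u - #|B|)%N by rewrite cardsD (setIidPr BF) cF.
have B_lt : (#|B| < u)%N.
  rewrite -subn_gt0 -cFB; case: w' w'U w'W => [w'|] w'U w'W.
    apply/card_gt0P; exists w'; apply/setDP; rewrite !in_set w'W; split=> //.
    by rewrite in_set in w'U.
  by rewrite w'U in noneU.
have [leB|gtB] := leqP #|B|.*2 u.
  have [I cI mI] := cut_misses dk eu BF noB.
  by have := no_cut I; rewrite mI cI => /(_ B_gt0 leB).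
(* [B] is more than half of the free vertices: name the cut by its smaller side instead. *)
have [||I cI mI] := cut_misses (W := free (run S k) :\: B) dk eu.
- exact: subsetDl.
- move=> x y xF; rewrite setDDr setDv set0U => /setIP[_ yB].
  by rewrite edge_graph_sym noB.
- have := no_cut I; rewrite mI cI cFB subn_gt0 => /(_ B_lt) H.
  by have /H : ((u - #|B|).*2 <= u)%N by lia.
Qed.

Lemma card_bad_le (u m : nat) :
  (0 < u <= n)%N ->
  (#|[set S : {set edge n} | (#|S| == m) && ~~ `[< exists2 p,
       is_stick (dfs_tree (augment (edge_graph S)) None pick) None p &
       size p = (n - u)%N >]]| <=
   n * 'C('C(n, 2) - u, m) +
   \sum_(I : {set 'I_u} | (0 < #|I|) && (#|I|.*2 <= u))
     'C('C(n, 2) - #|I| * (u - #|I|), m))%N.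
Proof.
move=> hu; rewrite -card_edge.
(* Index [t] stands for time [t + 1], since time 0 cannot fail; the [n - u] relevant times are
   rounded up to [n]. *)
pose stuck (t : 'I_n) (S : {set edge n}) := (#|S| == m) &&
  misses dfs_query dfs_update dfs_query dfs_start t.+1 u S.
pose split (I : {set 'I_u}) (S : {set edge n}) := (#|S| == m) &&
  misses dfs_query dfs_update (cut_target I) dfs_start (n - u) (#|I| * (u - #|I|)) S.
have sub : [set S : {set edge n} | (#|S| == m) && ~~ `[< exists2 p,
       is_stick (dfs_tree (augment (edge_graph S)) None pick) None p &
       size p = (n - u)%N >]] \subset
   (\bigcup_(t : 'I_n) [set S | stuck t S]) :|:
   (\bigcup_(I : {set 'I_u} | (0 < #|I|) && (#|I|.*2 <= u)) [set S | split I S])%N.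
  apply/subsetP => S; rewrite inE => /andP[cS /asboolPn bad].
  apply/negPn/negP; rewrite in_setU negb_or => /andP[/bigcupP nst /bigcupP nsp].
  apply: bad; apply: stick_of_no_miss => // [t /andP[t_gt0 le_t]|I I_gt0 leI].
    apply/negP => mt; apply: nst; have ltn : (t.-1 < n)%N by lia.
    by exists (Ordinal ltn); rewrite // inE /stuck cS /= prednK.
  apply/negP => mI; apply: nsp; exists I; first by rewrite I_gt0.
  by rewrite inE /split cS.
apply: leq_trans (subset_leq_card sub) _.
apply: leq_trans (leq_card_setU _ _) _; apply: leq_add.
  apply: leq_trans (card_bigcup_le _ _) _.
  rewrite -[X in (_ <= X * _)%N]card_ord -sum_nat_const.
  by apply: leq_sum => t _; exact: card_misses.
apply: leq_trans (card_bigcup_le _ _) _.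
by apply: leq_sum => I _; exact: card_misses.
Qed.

End EdgeExposure.

(** * Numerical estimates *)

Section Estimates.

Variable R : realType.

Lemma bin_ratio_expR (N d m : nat) : (0 < N)%N -> (m <= N)%N ->
  'C(N - d, m)%:R / 'C(N, m)%:R <= expR (- (m%:R / N%:R * d%:R)) :> R.
Proof.
move=> N_gt0 lem; have NR : 0 < N%:R :> R by rewrite ltr0n.
have CR : 0 < 'C(N, m)%:R :> R by rewrite ltr0n bin_gt0.
have NmR : 0 < N%:R ^+ m :> R by rewrite exprn_gt0.
have -> : - (m%:R / N%:R * d%:R) = m%:R * (- (d%:R / N%:R)) :> R by ring.
rewrite expRM_natl; apply: (@le_trans _ _ (((N - d)%N%:R / N%:R) ^+ m)).
  rewrite expr_div_n ler_pdivrMr // mulrAC ler_pdivlMr // mulrC.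
  by rewrite -!natrX -!natrM ler_nat mulnC [leqRHS]mulnC bin_ratio.
apply: lerXn2r; rewrite ?nnegrE ?expR_ge0 ?divr_ge0 ?ler0n //.
have [leNd|ltdN] := leqP N d.
  by move: leNd; rewrite -subn_eq0 => /eqP ->; rewrite mul0r expR_ge0.
rewrite natrB 1?ltnW // mulrBl divff ?gt_eqF //.
exact: expR_ge1Dx.
Qed.

Lemma sum_expr_card (T : finType) (z : R) :
  \sum_(I : {set T}) z ^+ #|I| = (1 + z) ^+ #|T|.
Proof.
rewrite addrC -prodr_const bigA_distr /=.
apply: eq_bigr => I _; rewrite (bigID (mem I)) /=.
rewrite (eq_bigr (fun=> z)) => [|i ->//]; rewrite prodr_const.
by rewrite big1 ?mulr1 // => i /negbTE ->.
Qed.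

(** The constant and linear terms are kept exact, so that cancelling the subsets of size 0 and 1
    leaves a quadratic bound for the larger ones. *)
Lemma exprD1_le (u : nat) (z : R) : 0 <= z -> u%:R * z <= 1 ->
  (1 + z) ^+ u <= 1 + u%:R * z + (u%:R * z) ^+ 2.
Proof.
move=> z0; elim: u => [|u IH]; first by rewrite expr0 !mul0r expr0n /= !addr0.
rewrite -natr1 => leuz; have u0 : 0 <= u%:R :> R by [].
have leuz' : u%:R * z <= 1 by nra.
rewrite exprS; apply: (@le_trans _ _ ((1 + z) * (1 + u%:R * z + (u%:R * z) ^+ 2))).
  by rewrite ler_wpM2l ?IH // addr_ge0.
have uz0 : 0 <= u%:R * z by rewrite mulr_ge0.
have : u%:R * z * (u%:R * z) * z <= 1 * (u%:R * z) * z by rewrite !ler_wpM2r.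
rewrite !expr2; nra.
Qed.

(** To be used with [y = ln n] and [lam = m / N]. Four contributions are each at most
    [expR (7 - y)]: getting stuck, and cuts whose smaller side [a] satisfies [a = 1],
    [2 <= a <= u / 4] or [u / 4 < a]. *)
Lemma cut_sum_le (u : nat) (lam y : R) : (4 <= u)%N -> 7 <= y -> 0 <= lam ->
  lam <= 1 -> 2 * y - 3 <= lam * u%:R -> u%:R <= expR y ->
  expR y * expR (- (lam * u%:R)) +
  \sum_(I : {set 'I_u} | (0 < #|I|)%N && (#|I|.*2 <= u)%N)
    expR (- (lam * (#|I| * (u - #|I|))%N%:R)) <= 4 * expR 7 * expR (- y).
Proof.
move=> u4 y7 lam0 lam1 lamu uy.
(* [z ^+ a] serves for [a <= u / 4], where [lam (u - a) >= 3/4 (2 y - 3)]; [Y] serves for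
   [a > u / 4], where [a (u - a) >= 3/16 u^2]. *)
set z := expR (9 / 4 - 3 / 2 * y); set Y := expR (- (3 / 16 * u%:R * (2 * y - 3))).
have u4R : 4 <= u%:R :> R by rewrite (ler_nat _ 4).
have z0 : 0 <= z by exact: expR_ge0.
have term_le (I : {set 'I_u}) : (0 < #|I|)%N && (#|I|.*2 <= u)%N ->
    expR (- (lam * (#|I| * (u - #|I|))%N%:R)) <=
    (if #|I| == 1%N then expR (4 - 2 * y) else 0) +
    (if (2 <= #|I|)%N then z ^+ #|I| else 0) + Y.
  move=> /andP[I0 Iu]; set a := #|I| in I0 Iu *.
  have Y0 : 0 <= Y by exact: expR_ge0.
  have aR : a%:R * 2 <= u%:R :> R by rewrite -natrM muln2 ler_nat.
  have lea : (a <= u)%N by lia.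
  rewrite natrM natrB //.
  have [a1|an1] := eqVneq a 1%N.
    rewrite a1 /= addr0 -[leLHS]addr0 lerD // ler_expR; lra.
  have a2 : (2 <= a)%N by lia.
  rewrite a2 add0r.
  have [le4|gt4] := leqP (4 * a) u.
    rewrite -[leLHS]addr0 lerD // /z -expRM_natl ler_expR.
    have le4R : 4 * a%:R <= u%:R :> R by rewrite -natrM ler_nat.
    have a0R : 0 <= a%:R :> R by [].
    have H1 : 3 / 4 * u%:R <= u%:R - a%:R :> R by lra.
    have H2 : lam * (3 / 4 * u%:R) <= lam * (u%:R - a%:R) by rewrite ler_wpM2l.
    have H3 : 3 / 2 * y - 9 / 4 <= lam * (u%:R - a%:R) by lra.
    have : a%:R * (3 / 2 * y - 9 / 4) <= a%:R * (lam * (u%:R - a%:R)) by rewrite ler_wpM2l.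
    lra.
  have gt4R : u%:R <= 4 * a%:R :> R by rewrite -natrM ler_nat ltnW.
  rewrite -[leLHS]add0r lerD ?exprn_ge0 // ler_expR lerN2.
  have H1 : 3 / 16 * u%:R * u%:R <= a%:R * (u%:R - a%:R) :> R.
    (* The difference of the two sides of [H1] factors as this product. *)
    have : 0 <= (a%:R - u%:R / 4) * (3 / 4 * u%:R - a%:R) :> R by rewrite mulr_ge0 //; lra.
    lra.
  have H2 : lam * (3 / 16 * u%:R * u%:R) <= lam * (a%:R * (u%:R - a%:R)) by rewrite ler_wpM2l.
  have : 3 / 16 * u%:R * (2 * y - 3) <= 3 / 16 * u%:R * (lam * u%:R).
    by rewrite ler_wpM2l //; lra.
  lra.
have uz_le : u%:R * z <= expR (9 / 4 - y / 2).
  apply: (@le_trans _ _ (expR y * z)); first by rewrite ler_wpM2r.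
  by rewrite -expRD ler_expR; lra.
have uz1 : u%:R * z <= 1.
  by apply: le_trans uz_le _; rewrite -[leRHS]expR0 ler_expR; lra.
have t1 : expR y * expR (- (lam * u%:R)) <= expR 7 * expR (- y).
  by rewrite -!expRD ler_expR; lra.
have t2 : \sum_(I : {set 'I_u}) (if #|I| == 1%N then expR (4 - 2 * y) else 0)
    <= expR 7 * expR (- y).
  rewrite -big_mkcond /= sumr_const.
  have -> : #|[pred I : {set 'I_u} | #|I| == 1%N]| = u.
    rewrite -[RHS]bin1 -[X in 'C(X, _)](card_ord u) -card_draws.
    by apply: eq_card => I; rewrite !inE.
  rewrite -[leLHS]mulr_natl; apply: (@le_trans _ _ (expR y * expR (4 - 2 * y))).
    by rewrite ler_wpM2r // expR_ge0.
  by rewrite -!expRD ler_expR; lra.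
have t3 : \sum_(I : {set 'I_u}) (if (2 <= #|I|)%N then z ^+ #|I| else 0)
    <= expR 7 * expR (- y).
  have E : \sum_(I : {set 'I_u}) z ^+ #|I| =
      1 + u%:R * z + \sum_(I : {set 'I_u} | (2 <= #|I|)%N) z ^+ #|I|.
    rewrite (bigID (fun I : {set 'I_u} => (2 <= #|I|)%N)) /= addrC; congr (_ + _).
    rewrite (bigD1 set0) /=; last by rewrite cards0.
    rewrite cards0 expr0; congr (_ + _).
    rewrite (eq_big (fun I : {set 'I_u} => #|I| == 1%N) (fun=> z)) => [|I|I].
    - rewrite sumr_const mulr_natl; congr (_ *+ _).
      rewrite -[RHS]bin1 -[X in 'C(X, _)](card_ord u) -card_draws.
      by apply: eq_card => I; rewrite !inE.
    - by rewrite -cards_eq0; case: #|I| => [|[|]].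
    - by rewrite -cards_eq0; case: #|I| => [|[|]] //; rewrite expr1.
  rewrite -big_mkcond /=.
  have := exprD1_le z0 uz1; rewrite -[X in (1 + z) ^+ X](card_ord u) -sum_expr_card E.
  rewrite lerD2l => /le_trans; apply.
  apply: (@le_trans _ _ (expR (9 / 4 - y / 2) ^+ 2)).
    by rewrite lerXn2r ?nnegrE ?expR_ge0 ?mulr_ge0.
  by rewrite -expRM_natl -expRD ler_expR; lra.
have t4 : \sum_(I : {set 'I_u}) Y <= expR 7 * expR (- y).
  rewrite (eq_bigr (fun I : {set 'I_u} => Y * 1 ^+ #|I|)) => [|I _]; last first.
    by rewrite expr1n mulr1.
  (* There are [2^u <= expR u] subsets, and the total exponent is [- u (3/8 y - 25/16)], which
     [u >= 4] makes small enough. *)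
  rewrite -mulr_sumr sum_expr_card card_ord; apply: (@le_trans _ _ (Y * expR u%:R)).
    rewrite ler_wpM2l ?expR_ge0 // -[u%:R]mulr1 expRM_natl.
    by rewrite lerXn2r ?nnegrE ?expR_ge0 ?addr_ge0 ?expR_ge1Dx.
  rewrite -!expRD ler_expR.
  have : 4 * (3 / 8 * y - 25 / 16) <= u%:R * (3 / 8 * y - 25 / 16).
    by rewrite ler_wpM2r //; lra.
  lra.
apply: (@le_trans _ _ (expR y * expR (- (lam * u%:R)) + \sum_(I : {set 'I_u})
   ((if #|I| == 1%N then expR (4 - 2 * y) else 0) +
    (if (2 <= #|I|)%N then z ^+ #|I| else 0) + Y))).
  rewrite lerD2l; apply: le_trans (ler_sum _ term_le) _.
  rewrite big_mkcond /=; apply: ler_sum => I _; case: ifP => // _.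
  rewrite !addr_ge0 //; try exact: expR_ge0; case: ifP => // _.
    exact: expR_ge0.
  exact: exprn_ge0.
rewrite !big_split /=; set E := expR 7 * expR (- y) in t1 t2 t3 t4.
rewrite (_ : 4 * _ * _ = E + (E + E + E)); last by rewrite /E; ring.
exact: lerD t1 (lerD (lerD t2 t3) t4).
Qed.

(** Up to rounding, [m u] is [n^2 ln n] and ['C(n, 2)] is [n^2 / 2]; the loss of 3 absorbs the
    rounding of [m] and the floor in [u]. *)
Lemma edge_density_le (n i m : nat) : (3 <= n)%N ->
  (m <= 'C(n, 2))%N -> 0 <= ln (n%:R : R) ->
  `|m%:R - 2 ^+ i * n%:R * ln (n%:R : R)| < 1 ->
  2 * ln (n%:R : R) - 3 <= m%:R / 'C(n, 2)%:R * (n %/ 2 ^ i)%:R /\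
  2 * ln (n%:R : R) < (n %/ 2 ^ i)%:R + 1.
Proof.
move=> n3 lem; set y := ln _ => y0; rewrite ltr_norml => /andP[ltm _].
set u := (n %/ 2 ^ i)%N; set P : R := 2 ^+ i in ltm *.
have EP : (2 ^ i)%N%:R = P by rewrite natrX.
have P0 : 0 < P by rewrite exprn_gt0.
have EN : 2 * 'C(n, 2)%:R = n%:R * (n%:R - 1) :> R.
  have : (2 * 'C(n, 2) + n = n * n)%N by rewrite mul_bin_left bin1; nia.
  by move/(congr1 (fun k => k%:R : R)); rewrite natrD !natrM; lra.
have n3R : 3 <= n%:R :> R by rewrite (ler_nat _ 3).
have leuR : P * u%:R <= n%:R by rewrite -EP -natrM ler_nat mulnC leq_divM.
have ltuR : n%:R < P * (u%:R + 1).
  by rewrite -EP natr1 -natrM ltr_nat mulnC ltn_ceil // expn_gt0.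
have lemR : m%:R <= 'C(n, 2)%:R :> R by rewrite ler_nat.
have N0 : 0 < 'C(n, 2)%:R :> R by rewrite ltr0n bin_gt0; lia.
have leun : u%:R <= n%:R :> R by rewrite ler_nat leq_div.
(* Forced by [n P y - 1 < m <= n (n - 1) / 2]; it keeps [u] from being small. *)
have Py : 2 * (P * y) <= n%:R.
  rewrite -(ler_pM2l (_ : 0 < n%:R)); last by lra.
  nra.
split; last first.
  rewrite -(ltr_pM2l P0); lra.
rewrite mulrAC ler_pdivlMr //.
have H : n%:R * y * (n%:R - P) <= n%:R * y * (P * u%:R).
  by rewrite ler_wpM2l ?mulr_ge0 //; lra.
have H2 : n%:R * (2 * (P * y)) <= n%:R * n%:R by rewrite ler_wpM2l.
have H3 : (P * n%:R * y - 1) * u%:R <= m%:R * u%:R by rewrite ler_wpM2r //; lra.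
have H4 : 0 <= n%:R * y by rewrite mulr_ge0.
have H5 : 3 * n%:R <= n%:R * n%:R :> R by rewrite ler_wpM2r //; lra.
have H6 : (2 * y - 3) * (2 * 'C(n, 2)%:R) = (2 * y - 3) * (n%:R * (n%:R - 1)).
  by rewrite EN.
lra.
Qed.

End Estimates.

(** * Transfer to [gnm] and the final bound *)

Lemma gnm_edge_graph (n m : nat) (sigma : {perm edge n}) :
  gnm m sigma = edge_graph (prefix_set m sigma).
Proof.
apply/funext => u; apply/funext => v; rewrite /gnm /edge_graph /prefix_set.
rewrite -imset_comp; apply/mapP/imsetP => -[e eP ->]; first by exists e.
by exists e.
Qed.

Lemma uniform_prob_prefix_ge (R : realType) (E : finType) (m : nat)
    (bad : pred {set E}) (P : {perm E} -> Prop) : (m <= #|E|)%N ->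
  (forall sigma, ~~ bad (prefix_set m sigma) -> P sigma) ->
  1 - #|[set S : {set E} | (#|S| == m) && bad S]|%:R / 'C(#|E|, m)%:R <=
    uniform_prob R P.
Proof.
move=> lem HP; have C0 : 0 < 'C(#|E|, m)%:R :> R by rewrite ltr0n bin_gt0.
have F0 : 0 < #|{perm E}|%:R :> R.
  by rewrite ltr0n; apply/card_gt0P; exists 1%g.
have -> : #|[set S : {set E} | (#|S| == m) && bad S]|%:R / 'C(#|E|, m)%:R =
    #|[set s : {perm E} | bad (prefix_set m s)]|%:R / #|{perm E}|%:R :> R.
  apply/eqP; rewrite eqr_div ?lt0r_neq0 // -!natrM eqr_nat.
  by apply/eqP/esym; exact: card_prefix_pred.
rewrite /uniform_prob lerBlDr -mulrDl ler_pdivlMr // mul1r -natrD ler_nat.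
set G := [set t | _]; set B := [set s | _].
rewrite addnC -(cardsC B) leq_add2l; apply/subset_leq_card/subsetP => s.
by rewrite !inE => /HP Ps; apply/asboolP.
Qed.

Theorem theorem1p1 (R : realType) :
  exists C : R,
    forall (n i m : nat) (pick : dfs_rule (option 'I_n)),
      (0 < n)%N ->
      valid_rule pick ->
      (m <= 'C(n, 2))%N ->
      `|m%:R - 2 ^+ i * n%:R * ln (n%:R : R)| < 1 ->
      1 - C / n%:R <=
        uniform_prob R (fun sigma : {perm edge n} =>
          exists p : seq (option 'I_n),
            is_stick (dfs_tree (augment (gnm m sigma)) None pick) None p /\
            n%:R - n%:R / 2 ^+ i <= (size p)%:R :> R).
Proof.
(* Each of the four contributions in [cut_sum_le] costs [expR 7 / n]. *)
exists (4 * expR 7) => n i m pick n_gt0 pickP lem hm.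
have n0 : 0 < n%:R :> R by rewrite ltr0n.
(* Up to this threshold [1 - C / n] is at most 0; beyond it [ln n >= 7], as the estimates
   require. *)
have [small|large] := leP (n%:R : R) (4 * expR 7).
  apply: (@le_trans _ _ 0); last by rewrite /uniform_prob divr_ge0.
  by rewrite subr_le0 ler_pdivlMr // mul1r.
set y : R := ln n%:R.
have ny : expR y = n%:R by rewrite lnK // posrE.
have y7 : 7 <= y.
  rewrite -ler_expR ny; apply: le_trans (ltW large); have := expR_ge0 (7 : R); lra.
have n3 : (3 <= n)%N.
  rewrite -(ler_nat R) -ny; apply: le_trans (expR_ge1Dx y); lra.
have y0 : 0 <= y by lra.
have P0 : 0 < 2 ^+ i :> R by rewrite exprn_gt0.
have EP : (2 ^ i)%N%:R = 2 ^+ i :> R by rewrite natrX.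
set u := (n %/ 2 ^ i)%N.
have [lamu ltu] := edge_density_le n3 lem y0 hm.
have u4 : (4 <= u)%N by rewrite -(ler_nat R); move: ltu; rewrite -/u -/y; lra.
have leun : (u <= n)%N by exact: leq_div.
set N := 'C(n, 2) in lem lamu *; have N_gt0 : (0 < N)%N by rewrite bin_gt0; lia.
have NR : 0 < N%:R :> R by rewrite ltr0n.
set lam := m%:R / N%:R : R in lamu.
have lam0 : 0 <= lam by rewrite divr_ge0.
have lam1 : lam <= 1 by rewrite ler_pdivrMr // mul1r ler_nat.
have uy : u%:R <= expR y by rewrite ny ler_nat.
pose good (S : {set edge n}) := `[< exists2 p,
  is_stick (dfs_tree (augment (edge_graph S)) None pick) None p &
  size p = (n - u)%N >].
have := @uniform_prob_prefix_ge R (edge n) m (fun S => ~~ good S) _ _ _.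
rewrite card_edge => /(_ _ lem) H.
apply: le_trans (H _ _) => [|sigma]; last first.
  rewrite negbK => /asboolP[p stick_p size_p]; exists p.
  rewrite gnm_edge_graph size_p; split=> //.
  rewrite natrB // lerD2l lerN2 ler_pdivlMr // -EP -natrM ler_nat.
  exact: leq_divM.
rewrite lerD2l lerN2.
have C0 : 0 < 'C(N, m)%:R :> R by rewrite ltr0n bin_gt0.
rewrite ler_pdivrMr //.
have hu : (0 < u <= n)%N by rewrite leun andbT (leq_trans _ u4).
have := card_bad_le pickP m hu; rewrite -(ler_nat R) => /le_trans; apply.
have := cut_sum_le u4 y7 lam0 lam1 lamu uy.
have -> : expR (- y) = n%:R^-1 by rewrite expRN ny.
rewrite ny => bound; apply: le_trans (ler_wpM2r (ltW C0) bound); rewrite -/N.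
rewrite natrD natrM natr_sum mulrDl mulr_suml; apply: lerD.
  rewrite -mulrA ler_wpM2l ?ler0n // -ler_pdivrMr //.
  exact: bin_ratio_expR.
apply: ler_sum => I _; rewrite -ler_pdivrMr //; exact: bin_ratio_expR.
Qed.
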